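(* Let $\mathcal{I}$ be a subset of $\mathcal{V}(E)$. For $V\in\mathcal{V}(E)$ set $\mathcal{I}(V)=\{I\in\mathcal{I}\mid I\leq V\}$ and denote by $\mathcal{I}_{\max}(V)$ the set of subspaces in $\mathcal{I}(V)$ of maximal dimension. Let $\tilde{\rho}:\mathcal{I}\longrightarrow\mathbb{Q}$ and $\mu\in\mathbb{Q}_{>0}$ be such that $\mu\tilde{\rho}(I)\in\mathbb{Z}$ for all $I\in\mathcal{I}$. Suppose $(\mathcal{I},\tilde{\rho})$ satisfies the following. (I1) $\{0\}\in\mathcal{I}$. (I2) If $I\in\mathcal{I}$ and $J\leq I$, then $J\in\mathcal{I}$. (I3) If $I,J\in\mathcal{I}$ and $\dim I<\dim J$, then there exists $x\in J\setminus I$ such that $I\oplus\langle x\rangle\in\mathcal{I}$. (I4) Let $V,W\in\mathcal{V}(E)$ and $I\in\mathcal{I}_{\max}(V)$, $J\in\mathcal{I}_{\max}(W)$. Then there exists a space $K\in\mathcal{I}_{\max}(V+W)$ that is contained in $I+J$. (R1$'$) $0\leq \mu^{-1}\dim I\leq\tilde{\rho}(I)\leq\dim I$ for all $I\in\mathcal{I}$. (R2$'$) If $I,J\in\mathcal{I}$ are such that $I\leq J$, then $\tilde{\rho}(I)\leq\tilde{\rho}(J)$. (R3$'$) For all $I,J\in\mathcal{I}$ we have $\max\{\tilde{\rho}(K)\mid K\in\mathcal{I}(I+J)\}+\tilde{\rho}(I\cap J)\leq \tilde{\rho}(I)+\tilde{\rho}(J)$. (R4$'$) For all $V\in\mathcal{V}(E)$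 and $I,J\in\mathcal{I}_{\max}(V)$ we have $\tilde{\rho}(I)=\tilde{\rho}(J)$. (C) If $V\in\mathcal{V}(E)$ is such that (i) all proper subspaces of $V$ are in $\mathcal{I}$, and (ii) $\max\{\tilde{\rho}(I)\mid I\in\mathcal{I}(V)\}\geq\mu^{-1}\dim V$, then $V$ is in $\mathcal{I}$. Let $\mathcal{M}=(E,\rho)$ be the $q$-polymatroid with denominator $\mu$ given by \[ \rho:\mathcal{V}(E)\longrightarrow\mathbb{Q},\quad V\longmapsto \max\{\tilde{\rho}(I)\mid I\in\mathcal{I}(V)\}. \] Then $\mathcal{I}=\mathcal{I}_\mu(\mathcal{M})$.
   Context: Throughout, $\mathbb{F}=\mathbb{F}_q$ is a finite field and $E$ is a finite-dimensional $\mathbb{F}$-vector space. $V\leq W$ means that $V$ is a subspace of $W$, $\mathcal{V}(E)$ is the set of all subspaces of $E$, and $\langle x\rangle$ is the span of $x$. A $q$-rank function on $E$ is a map $\rho:\mathcal{V}(E)\to\mathbb{Q}_{\geq0}$ such that for all $V,W\in\mathcal{V}(E)$: (R1) $0\leq\rho(V)\leq\dim V$; (R2) $V\leq W$ implies $\rho(V)\leq\rho(W)$; (R3) $\rho(V+W)+\rho(V\cap W)\leq\rho(V)+\rho(W)$. A $q$-polymatroid on $E$ is a pair $\mathcal{M}=(E,\rho)$ with $\rho$ a $q$-rank function on $E$. A number $\mu\in\mathbb{Q}_{>0}$ is a denominator of $\mathcal{M}$ if $\mu\rho(V)\in\mathbb{N}_0$ for all $V\in\mathcal{V}(E)$. (Under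 conditions (I1)–(I4) and (R1$'$)–(R4$'$) of the claim, the pair $(E,\rho)$ defined there is indeed a $q$-polymatroid with denominator $\mu$; this is a preceding theorem of the paper.) Let $\mathcal{M}=(E,\rho)$ be a $q$-polymatroid with denominator $\mu$. A space $I\in\mathcal{V}(E)$ is $\mu$-independent if $\rho(J)\geq\frac{\dim J}{\mu}$ for all subspaces $J\leq I$. Set $\mathcal{I}_\mu(\mathcal{M})=\{I\in\mathcal{V}(E)\mid I \text{ is } \mu\text{-independent}\}$. *)

(* Defs.v *)
From HB Require Import structures.
From mathcomp Require Import all_boot all_order all_algebra.

Set Implicit Arguments.
Unset Strict Implicit.
Unset Printing Implicit Defensive.

Import Order.TTheory GRing.Theory Num.Theory.
Import VectorInternalTheory.
Local Open Scope ring_scope.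

(* Over a finite field {vspace E} is finite (a subspace is a canonical
   generating matrix), so a collection of subspaces is a {set {vspace E}}. *)
HB.instance Definition _ (F : finFieldType) (E : vectType F) :=
  [Countable of {vspace E} by <:].
HB.instance Definition _ (F : finFieldType) (E : vectType F) :=
  [Finite of {vspace E} by <:].

Section QPolymatroid.
Variables (F : finFieldType) (E : vectType F).
Implicit Types U V W I J K : {vspace E}.

Record q_polymatroid := QPolymatroid {
  rank :> {vspace E} -> rat;
  rank_bounds : forall V, 0 <= rank V <= (\dim V)%:R;
  rank_mono : forall V W, (V <= W)%VS -> rank V <= rank W;
  rank_submod : forall V W,
    rank (V + W)%VS + rank (V :&: W)%VS <= rank V + rank W
}.

Definition is_denominator (M : q_polymatroid) (mu : rat) : Prop :=
  0 < mu /\ forall V, mu * rank M V \is a Num.nat.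

Definition mu_independent (M : q_polymatroid) (mu : rat) I : bool :=
  [forall J : {vspace E}, (J <= I)%VS ==> ((\dim J)%:R / mu <= rank M J)].

Definition mu_independent_spaces (M : q_polymatroid) (mu : rat) :
    {set {vspace E}} :=
  [set I | mu_independent M mu I].

Section Independence.
(* Only the values of rho on cI are ever used. *)
Variables (cI : {set {vspace E}}) (rho : {vspace E} -> rat).

Definition subs_in V : {set {vspace E}} := [set I in cI | (I <= V)%VS].

Definition max_subs_in V : {set {vspace E}} :=
  [set I in subs_in V | [forall J in subs_in V, (\dim J <= \dim I)%N]].

(* max {rho I | I in cI, I <= V}.  The default element 0 of [arg max] belongs to
   subs_in V as soon as 0 is in cI; see max_rankP. *)
Definition max_rank V : rat := rho [arg max_(I > 0%VS in subs_in V) rho I]%O.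

Lemma max_rankP V : 0%VS \in cI ->
  (exists2 I, I \in subs_in V & max_rank V = rho I) /\
  (forall I, I \in subs_in V -> rho I <= max_rank V).
Proof.
move=> I1; rewrite /max_rank; case: arg_maxP => [|K KV Kmax].
  by rewrite inE I1 sub0v.
by split=> //; exists K.
Qed.

Record q_independence_axioms (mu : rat) : Prop := QIndependenceAxioms {
  axI1 : 0%VS \in cI;
  axI2 : forall I J, I \in cI -> (J <= I)%VS -> J \in cI;
  (* the sum I + <[x]> is direct because x \notin I *)
  axI3 : forall I J, I \in cI -> J \in cI -> (\dim I < \dim J)%N ->
    exists x, [/\ x \in J, x \notin I & (I + <[x]>)%VS \in cI];
  axI4 : forall V W I J, I \in max_subs_in V -> J \in max_subs_in W ->
    exists2 K, K \in max_subs_in (V + W)%VS & (K <= I + J)%VS;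
  axR1 : forall I, I \in cI ->
    [/\ 0 <= mu^-1 * (\dim I)%:R, mu^-1 * (\dim I)%:R <= rho I
      & rho I <= (\dim I)%:R];
  axR2 : forall I J, I \in cI -> J \in cI -> (I <= J)%VS -> rho I <= rho J;
  axR3 : forall I J, I \in cI -> J \in cI ->
    max_rank (I + J)%VS + rho (I :&: J)%VS <= rho I + rho J;
  axR4 : forall V I J, I \in max_subs_in V -> J \in max_subs_in V ->
    rho I = rho J
}.

Definition closure_axiom (mu : rat) : Prop := forall V,
  (forall U, (U <= V)%VS -> U != V -> U \in cI) ->
  mu^-1 * (\dim V)%:R <= max_rank V -> V \in cI.

Section Induced.
Variables (mu : rat) (A : q_independence_axioms mu).

Lemma max_rank_ge V I : I \in cI -> (I <= V)%VS -> rho I <= max_rank V.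
Proof.
by move=> cII IV; have [_] := max_rankP V (axI1 A); apply; rewrite inE cII.
Qed.

Lemma max_rank_bounds V : 0 <= max_rank V <= (\dim V)%:R.
Proof.
have [[I]] := max_rankP V (axI1 A).
rewrite inE => /andP[cII IV] -> _; have [h0 h1 h2] := axR1 A cII.
by rewrite (le_trans h0 h1) (le_trans h2) // ler_nat dimvS.
Qed.

Lemma max_rank_mono V W : (V <= W)%VS -> max_rank V <= max_rank W.
Proof.
move=> VW; have [[I]] := max_rankP V (axI1 A).
rewrite inE => /andP[cII IV] -> _.
exact: max_rank_ge (subv_trans IV VW).
Qed.

Lemma max_subsP V I : reflect
  [/\ I \in cI, (I <= V)%VS
    & forall J, J \in cI -> (J <= V)%VS -> (\dim J <= \dim I)%N]
  (I \in max_subs_in V).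
Proof.
rewrite inE inE -andbA; apply: (iffP and3P) => [[cII IV /forall_inP h]|[cII IV h]].
  by split=> // J cJ JV; apply: h; rewrite inE cJ.
by split=> //; apply/forall_inP => J; rewrite inE => /andP[]; apply: h.
Qed.

Lemma max_subs_extend V I : I \in cI -> (I <= V)%VS ->
  exists2 J, J \in max_subs_in V & (I <= J)%VS.
Proof.
have [n] := ubnP (\dim V - \dim I)%N; elim: n I => // n IHn I ltn cII IV.
case: (boolP (I \in max_subs_in V)) => [mI|nmI]; first by exists I.
have [J cJ /andP[JV ltIJ]] : exists2 J, J \in cI & (J <= V)%VS && (\dim I < \dim J)%N.
  apply/exists_inP; apply: contraR nmI => /exists_inPn h.
  apply/max_subsP; split=> // J cJ JV.
  by have := h J cJ; rewrite JV /= -leqNgt.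
have [x [xJ xI cIx]] := axI3 A cII cJ ltIJ.
have IxV : (I + <[x]> <= V)%VS.
  by rewrite subv_add IV -memvE (subvP JV).
have ltIx : (\dim I < \dim (I + <[x]>))%N.
  rewrite ltnNge; apply: contra xI => dimIx.
  have /eqP-> : I == (I + <[x]>)%VS by rewrite eqEdim addvSl.
  by rewrite memvE addvSr.
have [|K mK IxK] := IHn (I + <[x]>)%VS _ cIx IxV.
  rewrite ltnS in ltn; apply: leq_trans ltn.
  by apply: ltn_sub2l => //; apply: leq_trans ltIx (dimvS IxV).
by exists K => //; apply: subv_trans IxK; apply: addvSl.
Qed.

Lemma max_rankE V I : I \in max_subs_in V -> max_rank V = rho I.
Proof.
move=> mI; have [cII IV _] := max_subsP _ _ mI.
apply/le_anti; rewrite max_rank_ge // andbT.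
have [[K]] := max_rankP V (axI1 A); rewrite inE => /andP[cK KV] -> _.
have [J mJ KJ] := max_subs_extend cK KV.
have [cJ _ _] := max_subsP _ _ mJ.
by rewrite (axR4 A mI mJ) (axR2 A).
Qed.

Lemma max_rank_submod V W :
  max_rank (V + W)%VS + max_rank (V :&: W)%VS <= max_rank V + max_rank W.
Proof.
have [K0 mK0 _] := max_subs_extend (axI1 A) (sub0v (V :&: W)%VS).
have [cK0 K0VW K0max] := max_subsP _ _ mK0.
move: (K0VW); rewrite subv_cap => /andP[K0V K0W].
have [I mI K0I] := max_subs_extend cK0 K0V.
have [J mJ K0J] := max_subs_extend cK0 K0W.
have [[cII IV _] [cJ JW _]] := (max_subsP _ _ mI, max_subsP _ _ mJ).
have K0E : (I :&: J)%VS = K0.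
  apply/esym/eqP; rewrite eqEdim subv_cap K0I K0J /=; apply: K0max.
    exact: (axI2 A cII (capvSl _ _)).
  exact: capvS.
have [K mK KIJ] := axI4 A mI mJ; have [cK _ _] := max_subsP _ _ mK.
rewrite (max_rankE mK0) (max_rankE mI) (max_rankE mJ) (max_rankE mK).
apply: le_trans (axR3 A cII cJ).
by rewrite K0E lerD2r max_rank_ge.
Qed.

Definition induced_q_polymatroid : q_polymatroid :=
  QPolymatroid max_rank_bounds max_rank_mono max_rank_submod.

Lemma induced_denominator :
  0 < mu -> (forall I, I \in cI -> mu * rho I \is a Num.int) ->
  is_denominator induced_q_polymatroid mu.
Proof.
move=> mu_gt0 rho_int; split=> // V.
rewrite natrEint mulr_ge0 ?(ltW mu_gt0) ?andbT //=; last first.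
  by case/andP: (max_rank_bounds V).
have [[I]] := max_rankP V (axI1 A); rewrite inE => /andP[cII _] -> _.
exact: rho_int.
Qed.

End Induced.
End Independence.
End QPolymatroid.

(* Main.v *)
Require Import Defs.
From mathcomp Require Import all_boot all_order all_algebra.

Set Implicit Arguments.
Unset Strict Implicit.
Unset Printing Implicit Defensive.

Import Order.TTheory GRing.Theory Num.Theory.
Local Open Scope ring_scope.

(** Both inclusions compare the induced rank with [dim / mu].  A member [I] of
    the family satisfies [dim J / mu <= rho J <= max_rank J] for each [J <= I],
    since such [J] are again members and compete in the maximum defining
    [max_rank J].  Conversely, independence passes to subspaces by its very
    form, so a minimal independent space outside the family would have all its
    proper subspaces in the family and a rank of at least [dim / mu]: this is
    precisely the configuration that the closure axiom rules out. *)

Lemma mu_independentP (F : finFieldType) (E : vectType F)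
    (M : q_polymatroid E) (mu : rat) (I : {vspace E}) :
  reflect (forall J : {vspace E}, (J <= I)%VS -> (\dim J)%:R / mu <= M J)
          (mu_independent M mu I).
Proof.
by apply: (iffP forallP) => indI J; [apply/implyP | apply/implyP/indI].
Qed.

Lemma mu_independentS (F : finFieldType) (E : vectType F)
    (M : q_polymatroid E) (mu : rat) (I J : {vspace E}) :
  (J <= I)%VS -> mu_independent M mu I -> mu_independent M mu J.
Proof.
move=> JI /mu_independentP indI; apply/mu_independentP => K KJ.
exact: indI (subv_trans KJ JI).
Qed.

Theorem theorem4p6 (F : finFieldType) (E : vectType F)
    (cI : {set {vspace E}}) (rho : {vspace E} -> rat) (mu : rat)
    (mu_gt0 : 0 < mu)
    (rho_int : forall I : {vspace E}, I \in cI -> mu * rho I \is a Num.int)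
    (ax : q_independence_axioms cI rho mu)
    (axC : closure_axiom cI rho mu) :
  cI = mu_independent_spaces (induced_q_polymatroid ax) mu.
Proof.
apply/setP => V; rewrite inE; apply/idP/idP => [cV|].
  apply/mu_independentP => J JV; rewrite mulrC.
  have cJ := axI2 ax cV JV.
  have [_ rhoJ _] := axR1 ax cJ.
  exact: le_trans rhoJ (max_rank_ge ax cJ (subvv J)).
have [n] := ubnP (\dim V); elim: n V => // n IHn V ltVn indV.
apply: axC => [U UV neqUV|]; last first.
  by rewrite mulrC; move/mu_independentP: indV; apply.
apply: IHn (mu_independentS UV indV).
have ltUV : (\dim U < \dim V)%N.
  by rewrite ltnNge; apply: contra neqUV => leVU; rewrite eqEdim UV.
exact: leq_trans ltUV ltVn.
Qed.
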